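(* Let $\mathfrak M$ be a partial Steiner triple system and $m\ge 3$ an integer. The structure $\circledast^{m}\mathfrak M$ does not contain any Fano subconfiguration. Actually, it is anti-Fano: no three diagonal points of a quadrangle contained in $\circledast^{m}\mathfrak M$ are on a line.
   Context: A partial Steiner triple system (PSTS) is a structure $\mathfrak M=\langle S,\mathcal L\rangle$ with point set $S$ and a family $\mathcal L$ of 3-element subsets of $S$ (lines) such that any two distinct points lie on at most one line. Points are collinear if they lie on a common line. $C_m$ is the cyclic group of integers modulo $m$. For an integer $m\ge 3$, the $m$-weaved configuration $\circledast^{m}\mathfrak M$ has point set $S\times C_m$ and its lines are all the sets $\{(a,i),(b,i),(c,i+1)\}$ with $\{a,b,c\}\in\mathcal L$ (in any ordering of $a,b,c$) and $i\in C_m$; it is again a PSTS. A Fano subconfiguration is a set of 7 points and 7 lines forming the projective plane $PG(2,2)$. A quadrangle is a set of four pairwise collinear points, no three of them on a line. It has three pairs of opposite sides (the sides are the lines joining pairs of its points; two sides are opposite if they join complementary pairs); a diagonal point is the common point of two opposite sides, if it exists. The anti-Fano property says that whenever all three diagonal points of a quadrangle exist, they do not lie on a common line. *)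

(* Defs.v *)
From mathcomp Require Import all_boot all_order all_algebra.
From mathcomp Require Import boolp classical_sets functions cardinality.

Set Implicit Arguments.
Unset Strict Implicit.
Unset Printing Implicit Defensive.

Local Open Scope classical_set_scope.
Local Open Scope ring_scope.

(* A configuration is given by its (possibly infinite) type T of points and
   the family L of its lines, each line being the set of its points. *)

Definition psts (T : Type) (L : set (set T)) : Prop :=
  (forall l, L l -> (l #= `I_3)%card) /\
  (forall (x y : T) (k l : set T), x <> y -> L k -> L l ->
     k x -> k y -> l x -> l y -> k = l).

(* a, b, c range over all orderings of a line of L.  Since 'Z_m is the ring of
   integers modulo m only for m > 1, this is to be used with m >= 3. *)
Definition weave (m : nat) (T : Type) (L : set (set T)) :
    set (set (T * 'Z_m)) :=
  [set l | exists (i : 'Z_m) (a b c : T),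
     L [set a; b; c] /\ l = [set (a, i); (b, i); (c, i + 1)]].
Arguments weave m {T} L _.

Definition collinear (T : Type) (L : set (set T)) (A : set T) : Prop :=
  exists2 l, L l & A `<=` l.

(* PG(2, F): the lines and the planes through 0 in F^3, ordered by inclusion *)
Definition PG2_points (F : fieldType) : set {vspace 'rV[F]_3} :=
  [set U | \dim U = 1%N].

Definition PG2_lines (F : fieldType) : set {vspace 'rV[F]_3} :=
  [set U | \dim U = 2%N].

(* That P has 7 points and B has 7 lines follows from the bijections f, g. *)
Definition fano_subconfiguration (T : Type) (L : set (set T))
    (P : set T) (B : set (set T)) : Prop :=
  B `<=` L /\
  exists (f : {vspace 'rV['F_2]_3} -> T) (g : {vspace 'rV['F_2]_3} -> set T),
    [/\ set_bij (@PG2_points 'F_2) P f,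
        set_bij (@PG2_lines 'F_2) B g &
        forall U W, PG2_points U -> PG2_lines W -> (g W (f U) <-> (U <= W)%VS)].

Definition quadrangle (T : Type) (L : set (set T)) (p q r s : T) : Prop :=
  [/\ [/\ p <> q, p <> r & p <> s] /\ [/\ q <> r, q <> s & r <> s],
      [/\ collinear L [set p; q], collinear L [set p; r]
        & collinear L [set p; s]],
      [/\ collinear L [set q; r], collinear L [set q; s]
        & collinear L [set r; s]]
    & [/\ ~ collinear L [set p; q; r], ~ collinear L [set p; q; s],
          ~ collinear L [set p; r; s] & ~ collinear L [set q; r; s]]].

(* x is a common point of the opposite sides pq and rs *)
Definition diagonal_point (T : Type) (L : set (set T)) (p q r s x : T) : Prop :=
  exists k l : set T,
    [/\ L k, L l, [set p; q] `<=` k, [set r; s] `<=` l & (k `&` l) x].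

Definition anti_fano (T : Type) (L : set (set T)) : Prop :=
  forall p q r s x y z : T, quadrangle L p q r s ->
    diagonal_point L p q r s x ->
    diagonal_point L p r q s y ->
    diagonal_point L p s q r z ->
    ~ collinear L [set x; y; z].

(* Main.v *)
(** Write each point of the weaving as (a, i), where i is its level; the levels
    on a line are i, i, i + 1 in some order.  A quadrangle with three collinear
    diagonal points yields seven points and seven lines with the Fano incidence,
    so it suffices to exclude such levels on the Fano plane.  As any two points
    are collinear, all levels lie in {i - 1, i, i + 1} for a fixed i, and since
    2 <> 0 in Z/m they may be recoded in F_3 with the same property for each
    line.  In F_3 a triple i, i, i + 1 has sum 1, so adding up the seven lines
    gives 7 = 1; but every point is on three lines, so this sum is also 0. *)
Require Import Defs.
From mathcomp Require Import all_boot all_order all_algebra.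
From mathcomp Require Import boolp classical_sets functions cardinality.
From mathcomp Require Import ring.

Set Implicit Arguments.
Unset Strict Implicit.
Unset Printing Implicit Defensive.

Import GRing.Theory.

Local Open Scope classical_set_scope.
Local Open Scope ring_scope.

(** * Levels along a line and their coding in F_3 *)

Section Levels.
Variable R : nzRingType.
Implicit Types a p u v w : R.

Definition weave_levels u v w :=
  [|| (u == v) && (w == u + 1), (u == w) && (v == u + 1)
    | (v == w) && (u == v + 1)].

Lemma weave_levelsCA u v w : weave_levels u v w = weave_levels v u w.
Proof.
by rewrite /weave_levels (eq_sym u v); case: eqVneq => [->|_] //=; rewrite orbC.
Qed.

Lemma weave_levelsAC u v w : weave_levels u v w = weave_levels u w v.
Proof. by rewrite /weave_levels (eq_sym v w) orbCA; case: (eqVneq w v) => // ->. Qed.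

Hypothesis two_neq0 : 1 + 1 != 0 :> R.

Fact neq1 a : (a + 1 == a) = false.
Proof. by rewrite -{2}[a]addr0 (inj_eq (addrI a)) oner_eq0. Qed.

Fact neq2 a : (a + 1 + 1 == a) = false.
Proof. by rewrite -addrA -{2}[a]addr0 (inj_eq (addrI a)) (negbTE two_neq0). Qed.

(** Two equal levels force the next one up; of two distinct levels one is the successor of the
    other, and the lower one is repeated. As 2 <> 0, they cannot be successors of each other. *)
Lemma weave_levels_inj u v w w' :
  weave_levels u v w -> weave_levels u v w' -> w = w'.
Proof.
move=> /or3P[] /andP[/eqP e /eqP f] /or3P[] /andP[/eqP g /eqP h]; subst => //;
  first [by move/eqP: g; rewrite ?neq1 // eq_sym neq1
        | by move/eqP: h; rewrite ?neq1 // eq_sym ?neq1 ?neq2].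
Qed.

(** These are the levels that can share a line with a point of level [p]. *)
Definition near p u := [|| u == p, u == p + 1 | p == u + 1].

(* The default value 2 stands for p - 1; code3 is meant for u near p. *)
Definition code3 p u : 'F_3 := if u == p then 0 else if u == p + 1 then 1 else 2.

Lemma weave_levels_near u v w : weave_levels u v w -> near u v.
Proof.
by rewrite /near => /or3P[] /andP[/eqP e /eqP f]; subst; rewrite eqxx ?orbT.
Qed.

(** The levels p - 1, p, p + 1 are distinct and get the codes 2, 0, 1; the step from p - 1 to p
    wraps around in F_3. *)
Lemma code3S p u : near p u -> near p (u + 1) -> code3 p (u + 1) = code3 p u + 1.
Proof.
move=> /or3P[] /eqP-> ; rewrite /near /code3 ?eqxx ?neq1 ?neq2 //=.
  by move=> _; apply/eqP.
by rewrite ![u == _]eq_sym ?neq1 neq2 => _; apply/eqP.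
Qed.

Lemma code3_line p u v w : near p u -> near p v -> near p w ->
  weave_levels u v w -> code3 p u + code3 p v + code3 p w = 1.
Proof.
have step a : near p a -> near p (a + 1) ->
    code3 p a + code3 p a + code3 p (a + 1) = 1.
  move=> na na1; rewrite code3S //.
  have three0 : 3%:R = 0 :> 'F_3 by apply/eqP.
  by rewrite addrA -mulr2n -mulrSr -mulr_natr three0 mulr0 add0r.
move=> pu pv pw /or3P[] /andP[/eqP e /eqP f]; subst.
- exact: step.
- by rewrite addrAC step.
- by rewrite -addrA addrC step.
Qed.

(** The Fano plane is presented as a quadrangle [p], [q], [r], [s] with diagonal points [x], [y],
    [z]: its lines are the six sides and the line through the diagonal points. *)
Lemma no_fano_weave_levels (p q r s x y z : R) :
  weave_levels p q x -> weave_levels r s x ->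
  weave_levels p r y -> weave_levels q s y ->
  weave_levels p s z -> weave_levels q r z -> weave_levels x y z -> False.
Proof.
move=> lpqx lrsx lpry lqsy lpsz lqrz lxyz.
(* The three lines through [p] cover the plane, so [p] serves as the reference level for all seven
   codes. *)
have np : near p p by rewrite /near eqxx.
have nq := weave_levels_near lpqx; have nr := weave_levels_near lpry.
have ns := weave_levels_near lpsz.
have nx : near p x by apply: (@weave_levels_near _ _ q); rewrite weave_levelsAC.
have ny : near p y by apply: (@weave_levels_near _ _ r); rewrite weave_levelsAC.
have nz : near p z by apply: (@weave_levels_near _ _ s); rewrite weave_levelsAC.
have sum7 :
    code3 p p + code3 p q + code3 p x + (code3 p r + code3 p s + code3 p x)
    + (code3 p p + code3 p r + code3 p y) + (code3 p q + code3 p s + code3 p y)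
    + (code3 p p + code3 p s + code3 p z) + (code3 p q + code3 p r + code3 p z)
    + (code3 p x + code3 p y + code3 p z) = 7%:R.
  rewrite (code3_line np nq nx) ?(code3_line nr ns nx) ?(code3_line np nr ny) //.
  rewrite (code3_line nq ns ny) ?(code3_line np ns nz) ?(code3_line nq nr nz) //.
  by rewrite (code3_line nx ny nz) //; apply/eqP.
have three0 : 3%:R = 0 :> 'F_3 by apply/eqP.
suff : 7%:R = 0 :> 'F_3 by move/eqP.
rewrite -sum7; transitivity ((code3 p p + code3 p q + code3 p r + code3 p s
  + code3 p x + code3 p y + code3 p z) * 3%:R); first ring.
by rewrite three0 mulr0.
Qed.
End Levels.

(** * Lines of the weaving *)

Lemma card3_neq (T : Type) (a b c : T) :
  ([set a; b; c] #= `I_3)%card -> [/\ a <> b, a <> c & b <> c].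
Proof.
(* A pair, even with [u = v], is an image of [I_2], into which [I_3] does not embed. *)
have two (u v : T) : ~ ([set u; v] #= `I_3)%card.
  move=> /card_eqPle[_ le3].
  have : (`I_3 #<= `I_2)%card; last by rewrite card_le_II.
  apply: card_le_trans le3 _.
  suff -> : [set u; v] = (fun i => if i == 0%N then u else v) @` `I_2.
    exact: card_image_le.
  apply/seteqP; split => [t [->|->]|t [i _ <-]] /=; [by exists 0%N|by exists 1%N|].
  by case: ifP; [left|right].
move=> abc; split=> e; move: abc; rewrite e.
- by rewrite setUid; apply: two.
- by rewrite setUAC setUid; apply: two.
- by rewrite -setUA setUid; apply: two.
Qed.

Section Weave.
Variables (T : Type) (L : set (set T)) (m : nat).
Hypotheses (hL : psts L) (hm : (3 <= m)%N).
Implicit Types u v w x : T * 'Z_m.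

(** The bound on [m] enters the proof through this fact. *)
Lemma Zp_two_neq0 : 1 + 1 != 0 :> 'Z_m.
Proof. by case: m hm => [|[|[|n]]]. Qed.

Let on_line u v w := L [set u.1; v.1; w.1] /\ weave_levels u.2 v.2 w.2.

Let on_lineAC u v w : on_line u v w -> on_line u w v.
Proof. by move=> [luvw lev]; split; rewrite 1?setUAC // weave_levelsAC. Qed.

Let on_lineCA u v w : on_line u v w -> on_line v u w.
Proof.
by move=> [luvw lev]; split; rewrite 1?(setUC [set v.1]) // weave_levelsCA.
Qed.

(** [weave] lists a line with the raised point last, while [u] and [v] may take any two places; the
    symmetries of [on_line] settle the six cases. *)
Lemma weave_line_pair l u v : weave m L l -> l u -> l v -> u <> v ->
  exists w, [/\ l = [set u; v; w], L [set u.1; v.1; w.1]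
    & weave_levels u.2 v.2 w.2].
Proof.
move=> [i [a [b [c [Labc ->]]]]].
have abc : on_line (a, i) (b, i) (c, i + 1).
  by split; rewrite // /weave_levels !eqxx.
have pair x y z : on_line x y z -> [set x; y; z] u -> [set x; y; z] v -> u <> v ->
    exists w, [set x; y; z] = [set u; v; w] /\ on_line u v w.
  move=> xyz; have yxz := on_lineCA xyz; have xzy := on_lineAC xyz.
  move=> [[->|->]|->] [[->|->]|->] // _.
  - by exists z.
  - by exists y; rewrite setUAC.
  - by exists z; rewrite (setUC [set x]).
  - by exists x; rewrite -setUA setUC; split=> //; apply: on_lineAC.
  - by exists y; rewrite setUC setUA; split=> //; apply: on_lineCA.
  - exists x; rewrite setUC (setUC [set x]) setUA; split=> //.
    exact/on_lineCA/on_lineAC.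
by move=> lu lv /(pair _ _ _ abc lu lv)[w [-> []]]; exists w.
Qed.

Lemma weave_line_levels l u v w : weave m L l -> l u -> l v -> l w ->
  u <> v -> u <> w -> v <> w -> weave_levels u.2 v.2 w.2.
Proof.
move=> Ll lu lv lw uv uw vw.
have [w' [el _ lev]] := weave_line_pair Ll lu lv uv.
by move: lw; rewrite el => -[[wu|wv]|->] //; [case: uw | case: vw].
Qed.

(** Both coordinates of the third point are determined by [u] and [v]: the first by the line of [L],
    the second by the levels. *)
Lemma weave_line_unique k l u v : weave m L k -> weave m L l ->
  k u -> k v -> l u -> l v -> u <> v -> k = l.
Proof.
move=> Lk Ll ku kv lu lv uv.
have [w [-> Lw levw]] := weave_line_pair Lk ku kv uv.
have [w' [-> Lw' levw']] := weave_line_pair Ll lu lv uv.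
suff -> : w = w' by [].
(* From [u <> v] alone the two points could differ only in level; lines of [L] having three points
   excludes this. *)
have [uv1 uw1 vw1] := card3_neq (hL.1 _ Lw).
apply: injective_projections; last first.
  exact: weave_levels_inj Zp_two_neq0 _ _ _ _ levw levw'.
have : [set u.1; v.1; w.1] = [set u.1; v.1; w'.1].
  apply: (hL.2 _ _ _ _ uv1 Lw Lw');
    by [left; left|left; right|left; left|left; right].
move=> e; have : [set u.1; v.1; w.1] w.1 by right.
by rewrite e => -[[/esym|/esym]|].
Qed.
End Weave.

(** * Fano subconfigurations, via vectors over F_2 *)

Lemma mem_vline_F2 (V : vectType 'F_2) (u v : V) :
  v \in <[u]>%VS -> v = 0 \/ v = u.
Proof.
move=> /vlineP[[[|[|k]] lk] ->] //.
- by left; rewrite (_ : Ordinal lk = 0) ?scale0r //; apply/eqP.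
- by right; rewrite (_ : Ordinal lk = 1) ?scale1r //; apply/eqP.
Qed.

Section FanoLevels.
Variables (T : Type) (L : set (set T)) (m : nat).
Hypothesis hm : (3 <= m)%N.
Variables (P : set (T * 'Z_m)) (B : set (set (T * 'Z_m))).
Hypothesis BL : B `<=` weave m L.
Variable f : {vspace 'rV['F_2]_3} -> T * 'Z_m.
Variable g : {vspace 'rV['F_2]_3} -> set (T * 'Z_m).
Hypothesis fP : set_bij (@PG2_points 'F_2) P f.
Hypothesis gB : set_bij (@PG2_lines 'F_2) B g.
Hypothesis fg : forall U W,
  PG2_points U -> PG2_lines W -> (g W (f U) <-> (U <= W)%VS).

Lemma PG2_vline (u : 'rV['F_2]_3) : u != 0 -> PG2_points <[u]>%VS.
Proof. by rewrite /PG2_points /= dim_vline => ->. Qed.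

(** Over F_2 distinct nonzero [u], [v] span a projective line with points [u], [v], [u + v]; [g]
    maps it to a line of the weaving, and [f] keeps its points distinct. *)
Lemma weave_levels_vline (u v : 'rV['F_2]_3) : u != 0 -> v != 0 -> u != v ->
  weave_levels (f <[u]>).2 (f <[v]>).2 (f <[u + v]>).2.
Proof.
move=> u0 v0 uv.
have oppr (w : 'rV['F_2]_3) : - w = w.
  by rewrite -scaleN1r (_ : -1 = 1) ?scale1r //; apply/eqP.
have uv0 : u + v != 0 by rewrite addr_eq0 oppr.
have uuv : u != u + v by rewrite -{1}[u]addr0 (inj_eq (addrI u)) eq_sym.
have vuv : v != u + v by rewrite -{1}[v]add0r (inj_eq (addIr v)) eq_sym.
have f_neq (x y : 'rV['F_2]_3) :
    x != 0 -> y != 0 -> x != y -> f <[x]>%VS <> f <[y]>%VS.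
  move=> x0 y0 xy fxy; case: fP => _ finj _.
  have := finj _ _ (mem_set (PG2_vline x0)) (mem_set (PG2_vline y0)) fxy.
  move=> exy; have : x \in <[y]>%VS by rewrite -exy memv_line.
  by move=> /mem_vline_F2[/eqP|/eqP]; [rewrite (negbTE x0)|rewrite (negbTE xy)].
have dimW : PG2_lines (<[u]> + <[v]>)%VS.
  rewrite /PG2_lines /= -[<[v]>%VS]span_seq1 -span_cons; apply/eqP.
  (* [free] unfolds to dimension equal to length, so linear independence remains to be shown. *)
  rewrite -[_ == _]/(free [:: u; v]) free_cons seq1_free v0 span_seq1 andbT.
  by apply/negP => /mem_vline_F2[/eqP|/eqP]; [rewrite (negbTE u0)|rewrite (negbTE uv)].
have gL : weave m L (g (<[u]> + <[v]>)%VS) by case: gB => gfun _ _; apply/BL/gfun.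
have on_g (x : 'rV['F_2]_3) : x != 0 ->
    x \in (<[u]> + <[v]>)%VS -> g (<[u]> + <[v]>)%VS (f <[x]>%VS).
  by move=> x0 xW; apply/fg; [exact: PG2_vline|exact: dimW|].
have uW : u \in (<[u]> + <[v]>)%VS by exact: (subvP (addvSl _ _)) (memv_line u).
have vW : v \in (<[u]> + <[v]>)%VS by exact: (subvP (addvSr _ _)) (memv_line v).
apply: (weave_line_levels gL); try exact: f_neq.
all: by apply: on_g => //; apply: memvD.
Qed.

Lemma no_PG2_F2_in_weave : False.
Proof.
(* With vectors given as triples, the conditions on explicit points are checked by computation. *)
pose e (t : 'F_2 * 'F_2 * 'F_2) : 'rV['F_2]_3 :=
  \row_j nth 0 [:: t.1.1; t.1.2; t.2] j.
have eD t t' : e t + e t' = e (t + t').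
  by apply/rowP => -[[|[|[|j]]] lj]; rewrite !mxE.
have e_inj : injective e.
  move=> [[a b] c] [[a' b'] c'] /rowP ee.
  have := ee (inord 0); have := ee (inord 1); have := ee (inord 2).
  by rewrite !mxE !inordK //= => -> -> ->.
have e0 : e 0 = 0 by apply/rowP => -[[|[|[|j]]] lj]; rewrite !mxE.
have line t t' t'' : t + t' == t'' -> t != 0 -> t' != 0 -> t != t' ->
    weave_levels (f <[e t]>).2 (f <[e t']>).2 (f <[e t'']>).2.
  move=> /eqP<- t0 t'0 tt'; rewrite -eD; apply: weave_levels_vline.
  - by rewrite -e0 (inj_eq e_inj).
  - by rewrite -e0 (inj_eq e_inj).
  - by rewrite (inj_eq e_inj).
(* The quadrangle is the standard basis with its sum; each diagonal point is the sum of two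
   vertices. *)
apply: (@no_fano_weave_levels 'Z_m (Zp_two_neq0 hm) (f <[e (1, 0, 0)]>).2
  (f <[e (0, 1, 0)]>).2 (f <[e (0, 0, 1)]>).2 (f <[e (1, 1, 1)]>).2
  (f <[e (1, 1, 0)]>).2 (f <[e (1, 0, 1)]>).2 (f <[e (0, 1, 1)]>).2);
  exact: line.
Qed.
End FanoLevels.

(** * Quadrangles and the anti-Fano property *)

Lemma weave_anti_fano (T : Type) (L : set (set T)) (m : nat) :
  psts L -> (3 <= m)%N -> anti_fano (weave m L).
Proof.
move=> hL hm p q r s x y z [[[pq pr ps] [qr qs rs]] _ _ [npqr npqs nprs nqrs]].
have noncol a b c k : ~ collinear (weave m L) [set a; b; c] ->
    weave m L k -> k a -> k b -> k c -> False.
  by move=> + Lk ka kb kc; apply; exists k => // t [[->|->]|->].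
have pair_sub (a b : T * 'Z_m) (k : set (T * 'Z_m)) : [set a; b] `<=` k -> k a /\ k b.
  by move=> abk; split; apply: abk; [left|right].
move=> [k1 [l1 [Lk1 Ll1 pqk1 rsl1 [k1x l1x]]]].
have [[k1p k1q] [l1r l1s]] :=
  conj (pair_sub _ _ _ pqk1) (pair_sub _ _ _ rsl1).
move=> [k2 [l2 [Lk2 Ll2 prk2 qsl2 [k2y l2y]]]].
have [[k2p k2r] [l2q l2s]] :=
  conj (pair_sub _ _ _ prk2) (pair_sub _ _ _ qsl2).
move=> [k3 [l3 [Lk3 Ll3 psk3 qrl3 [k3z l3z]]]].
have [[k3p k3s] [l3q l3r]] :=
  conj (pair_sub _ _ _ psk3) (pair_sub _ _ _ qrl3).
move=> [l Ll xyzl].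
have [lx ly lz] : [/\ l x, l y & l z].
  by split; apply: xyzl; [left; left|left; right|right].
(* A diagonal point equal to a vertex would put that vertex on a side joining two others. *)
have px : p <> x by move=> e; subst x; apply: (noncol _ _ _ _ nprs Ll1).
have qx : q <> x by move=> e; subst x; apply: (noncol _ _ _ _ nqrs Ll1).
have rx : r <> x by move=> e; subst x; apply: (noncol _ _ _ _ npqr Lk1).
have sx : s <> x by move=> e; subst x; apply: (noncol _ _ _ _ npqs Lk1).
have py : p <> y by move=> e; subst y; apply: (noncol _ _ _ _ npqs Ll2).
have qy : q <> y by move=> e; subst y; apply: (noncol _ _ _ _ npqr Lk2).
have ry : r <> y by move=> e; subst y; apply: (noncol _ _ _ _ nqrs Ll2).
have sy : s <> y by move=> e; subst y; apply: (noncol _ _ _ _ nprs Lk2).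
have pz : p <> z by move=> e; subst z; apply: (noncol _ _ _ _ npqr Ll3).
have qz : q <> z by move=> e; subst z; apply: (noncol _ _ _ _ npqs Lk3).
have rz : r <> z by move=> e; subst z; apply: (noncol _ _ _ _ nprs Lk3).
have sz : s <> z by move=> e; subst z; apply: (noncol _ _ _ _ nqrs Ll3).
(* If two diagonal points coincide, the two sides joining them to [p] share two points, hence are
   equal and contain three vertices. *)
have xy : x <> y.
  move=> e; subst y; have e := weave_line_unique hL hm Lk1 Lk2 k1p k1x k2p k2y px.
  by subst k2; apply: (noncol _ _ _ _ npqr Lk1).
have xz : x <> z.
  move=> e; subst z; have e := weave_line_unique hL hm Lk1 Lk3 k1p k1x k3p k3z px.
  by subst k3; apply: (noncol _ _ _ _ npqs Lk1).
have yz : y <> z.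
  move=> e; subst z; have e := weave_line_unique hL hm Lk2 Lk3 k2p k2y k3p k3z py.
  by subst k3; apply: (noncol _ _ _ _ nprs Lk2).
apply: (@no_fano_weave_levels 'Z_m (Zp_two_neq0 hm) p.2 q.2 r.2 s.2 x.2 y.2 z.2).
- exact: weave_line_levels Lk1 _ _ _ _ _ _.
- exact: weave_line_levels Ll1 _ _ _ _ _ _.
- exact: weave_line_levels Lk2 _ _ _ _ _ _.
- exact: weave_line_levels Ll2 _ _ _ _ _ _.
- exact: weave_line_levels Lk3 _ _ _ _ _ _.
- exact: weave_line_levels Ll3 _ _ _ _ _ _.
- exact: weave_line_levels Ll _ _ _ _ _ _.
Qed.

Theorem proposition2p6 (T : Type) (L : set (set T)) (m : nat)
    (hL : psts L) (hm : (3 <= m)%N) :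
  ~ (exists (P : set (T * 'Z_m)) (B : set (set (T * 'Z_m))),
       fano_subconfiguration (weave m L) P B) /\
  anti_fano (weave m L).
Proof.
split; last exact: weave_anti_fano.
by move=> [P [B [BL [f [g [fP gB fg]]]]]]; apply: (no_PG2_F2_in_weave hm BL fP gB fg).
Qed.
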